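(* In the bound $T_{\mathrm{EX}(k,f,G)}(\varepsilon)\le C\log(|V|/\varepsilon)\,T_{\mathrm{EX}(2,f,G)}(1/4)$ one cannot replace $T_{\mathrm{EX}(2,f,G)}(1/4)$ by $T_{\mathrm{EX}(1,f,G)}(1/4)$. That is, for every constant $C>0$ there exist a pair $(f,G)$, $G=(V,E)$, satisfying Assumption (A) of the context, a number $k\in\{1,\ldots,|V|-1\}$ and $\varepsilon\in(0,1)$ such that $$T_{\mathrm{EX}(k,f,G)}(\varepsilon)> C\,\log(|V|/\varepsilon)\,T_{\mathrm{EX}(1,f,G)}(1/4).$$
   Context: A finite hypergraph $G=(V,E)$ has finite vertex set $V$ and edge set $E\subseteq\mathcal P(V)$. For $e\in E$ let $\mathcal S_e$ be the symmetric group on the elements of $e$, and $f_e$ a probability measure on $\mathcal S_e$; write $f=\{f_e:e\in E\}$. A permutation $\sigma\in\mathcal S_e$ is extended to $V$ by fixing every vertex outside $e$. Let $\binom Vk=\{A\subseteq V:|A|=k\}$ and $(V)_k=\{\mathbf x\in V^k:\mathbf x(i)\ne\mathbf x(j)\ \forall i\neq j\}$; $\sigma$ acts on sets elementwise and on vectors coordinatewise. The $k$-particle exclusion process $\mathrm{EX}(k,f,G)$ is the continuous-time Markov chain on $\binom Vk$ with generator $Uh(A)=\sum_{e\in E}\sum_{\sigma\in\mathcal S_e}f_e(\sigma)(h(\sigma(A))-h(A))$. The $k$-particle interchange process $\mathrm{IP}(k,f,G)$ is the continuous-time Markov chain on $(V)_k$ with generator $Uh(\mathbf x)=\sum_{e\in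 E}\sum_{\sigma\in\mathcal S_e}f_e(\sigma)(h(\sigma(\mathbf x))-h(\mathbf x))$. For a continuous-time Markov process $X$ on a finite set $\Omega$ with transition probabilities $q_t(x,y)$ and equilibrium distribution $\pi$, $T_X(\varepsilon)=\inf\{t\ge0:\max_{x\in\Omega}\|q_t(x,\cdot)-\pi\|_{\mathrm{TV}}\le\varepsilon\}$. Assumption (A) on $(f,G)$: (1) $G$ is regular (every vertex lies in the same number of edges); (2) for every $e$, $f_e$ is constant on conjugacy classes of $\mathcal S_e$; (3) for every $e\in E$ and $v\in e$, $\sum_{\sigma\in\mathcal S_e}f_e(\sigma)\mathbf 1_{\{\sigma(v)=v\}}\le 1/5$; (4) $\mathrm{IP}(k,f,G)$ is irreducible for every $k\in\{1,\dots,|V|-1\}$. *)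

(* Defs.v *)
From HB Require Import structures.
From mathcomp Require Import all_boot all_order all_fingroup all_algebra.
From mathcomp Require Import all_classical all_reals all_analysis.
Import Order.TTheory GRing.Theory Num.Theory.
Import numFieldNormedType.Exports.

Set Implicit Arguments.
Unset Strict Implicit.
Unset Printing Implicit Defensive.

Local Open Scope classical_set_scope.
Local Open Scope ring_scope.

(* A continuous-time Markov chain on a finite type Omega is given by its
   generator U, an operator on functions Omega -> R. *)
Section ContinuousTimeChain.
Variables (R : realType) (Omega : finType).
Implicit Types (U : (Omega -> R) -> Omega -> R) (mu nu pi : Omega -> R).

Definition indicator (y : Omega) : Omega -> R := fun z => (z == y)%:R.

(* q_t(x, y) = (e^{tU} 1_y)(x), with e^{tU} = \sum_n (t^n / n!) U^n; for a
   linear U the series always converges, Omega being finite. *)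
Definition transition U (t : R) (x y : Omega) : R :=
  limn (series (fun n => t ^+ n / n`!%:R * iter n U (indicator y) x)).

(* For x != y, (U 1_y)(x) is the jump rate from x to y; the diagonal entries
   only contribute loops. *)
Definition irreducible_chain U : Prop :=
  forall x y, connect (fun x y => 0 < U (indicator y) x) x y.

(* The last conjunct is the equation pi U = 0, tested against functions. *)
Definition is_equilibrium U pi : Prop :=
  [/\ forall x, 0 <= pi x, \sum_x pi x = 1
    & forall h : Omega -> R, \sum_x pi x * U h x = 0].

(* Uniquely determined when the chain is irreducible. *)
Definition equilibrium U : Omega -> R := get (is_equilibrium U).

Definition tv_dist mu nu : R := 2^-1 * \sum_x `|mu x - nu x|.

(* The infimum is taken in the extended reals, so that the mixing time would be
   +oo, not 0, if no t were admissible. The 0 in the maximum is harmless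
   because distances are nonnegative. *)
Definition mixing_time U (eps : R) : \bar R :=
  ereal_inf [set t%:E | t in [set t : R | 0 <= t /\
    \big[Num.max/0]_(x : Omega) tv_dist (transition U t x) (equilibrium U)
      <= eps]].

End ContinuousTimeChain.

(* A hypergraph is given by its vertex type V and edge set E. The symmetric
   group S_e is [Sym e], the permutations of V supported in e, so that the
   extension of an element of S_e to V is built in. Only the values of f on
   pairs (e, s) with e \in E and s \in Sym e are ever used. *)
Section ShuffleGenerator.
Variables (R : realType) (V : finType) (E : {set {set V}}).
Variable f : {set V} -> {perm V} -> R.

Definition edge_distributions : Prop :=
  forall e, e \in E ->
    (forall s, s \in Sym e -> 0 <= f e s) /\ \sum_(s in Sym e) f e s = 1.

Definition shuffle_generator (Omega : Type) (act : {perm V} -> Omega -> Omega)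
    (h : Omega -> R) (x : Omega) : R :=
  \sum_(e in E) \sum_(s in Sym e) f e s * (h (act s x) - h x).

End ShuffleGenerator.

Section Configurations.
Variables (V : finType) (k : nat).

Definition ksubset := {A : {set V} | #|A| == k}.

Definition kinjective := {x : k.-tuple V | uniq x}.

Lemma card_perm_imset (s : {perm V}) (A : ksubset) : #|s @: val A| == k.
Proof. by rewrite card_imset ?(valP A)//; exact: perm_inj. Qed.

Lemma uniq_map_perm (s : {perm V}) (x : kinjective) :
  uniq (map_tuple s (val x)).
Proof. by rewrite (map_inj_uniq (@perm_inj _ s)); exact: (valP x). Qed.

Definition act_ksubset (s : {perm V}) (A : ksubset) : ksubset :=
  exist _ (s @: val A) (card_perm_imset s A).

Definition act_kinjective (s : {perm V}) (x : kinjective) : kinjective :=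
  exist _ (map_tuple s (val x)) (uniq_map_perm s x).

End Configurations.

Section Processes.
Variables (R : realType) (V : finType).

Definition EX (k : nat) (f : {set V} -> {perm V} -> R) (E : {set {set V}}) :
    (ksubset V k -> R) -> ksubset V k -> R :=
  shuffle_generator E f (@act_ksubset V k).

Definition IP (k : nat) (f : {set V} -> {perm V} -> R) (E : {set {set V}}) :
    (kinjective V k -> R) -> kinjective V k -> R :=
  shuffle_generator E f (@act_kinjective V k).

Arguments EX k f E : clear implicits.
Arguments IP k f E : clear implicits.

Definition regular_hypergraph (E : {set {set V}}) : Prop :=
  exists d : nat, forall v : V, #|[set e in E | v \in e]| = d.

Definition assumptionA (f : {set V} -> {perm V} -> R) (E : {set {set V}}) :
    Prop :=
  [/\ regular_hypergraph E,
      (forall e, e \in E -> forall s t, s \in Sym e ->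
         t \in (s ^: Sym e)%g -> f e t = f e s),
      (forall e v, e \in E -> v \in e ->
         \sum_(s in Sym e) f e s * (s v == v)%:R <= 5^-1)
    & (forall k, (1 <= k <= #|V| - 1)%N -> irreducible_chain (IP k f E))].

End Processes.

Arguments EX {R V} k f E.
Arguments IP {R V} k f E.

(* Main.v *)
(* Let a single edge carry all four vertices, and let its measure be (1 - d)
   times the uniform measure on the three double transpositions plus d times
   the uniform measure on S_4. One particle jumps to each other vertex at the
   same rate, so it mixes in a time bounded independently of d. The double
   transpositions preserve each of the three perfect matchings {A, ~: A} of
   the four vertices, so two particles leave the matching in which they start
   at rate at most d, and EX(2) is arbitrarily slow as d tends to 0. *)

Require Import Defs.
From HB Require Import structures.
From mathcomp Require Import all_boot all_order all_fingroup all_algebra.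
From mathcomp Require Import primitive_action.
From mathcomp Require alt.
From mathcomp Require Import all_classical all_reals all_analysis.
From mathcomp Require Import ring lra.
Import Order.TTheory GRing.Theory Num.Theory.
Import numFieldNormedType.Exports.

Set Implicit Arguments.
Unset Strict Implicit.
Unset Printing Implicit Defensive.

Local Open Scope ring_scope.

(** * The semigroup of a bounded linear operator on functions over a finite type *)

Section BoundedGenerator.
Local Open Scope classical_set_scope.
Local Open Scope ring_scope.
Variables (R : realType) (Omega : finType).
Variables (U : (Omega -> R) -> Omega -> R) (L : R).
Hypothesis L_ge0 : 0 <= L.
Hypothesis U_sum : forall (P : pred Omega) (F : Omega -> Omega -> R) x,
  U (fun z => \sum_(i | P i) F i z) x = \sum_(i | P i) U (F i) x.
Hypothesis U_bounded : forall (h : Omega -> R) (a : R),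
  (forall x, `|h x| <= a) -> forall x, `|U h x| <= L * a.

Let coeff (t : R) (h : Omega -> R) (x : Omega) (n : nat) : R :=
  t ^+ n / n`!%:R * iter n U h x.

Lemma iter_bounded h (a : R) n :
  (forall x, `|h x| <= a) -> forall x, `|iter n U h x| <= L ^+ n * a.
Proof.
move=> ha; elim: n => [|n IHn] x; first by rewrite expr0 mul1r.
by rewrite iterS exprS -mulrA; exact: U_bounded.
Qed.

Lemma coeff_bounded h (a t : R) x n : 0 <= t -> (forall x, `|h x| <= a) ->
  `|coeff t h x n| <= exp_coeff (L * t) n * a.
Proof.
move=> t0 ha; rewrite normrM ger0_norm ?divr_ge0 ?exprn_ge0 ?ler0n//.
have -> : exp_coeff (L * t) n * a = t ^+ n / n`!%:R * (L ^+ n * a).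
  by rewrite /exp_coeff /= exprMn; ring.
by rewrite ler_wpM2l ?iter_bounded ?divr_ge0 ?exprn_ge0 ?ler0n.
Qed.

(** Absolute convergence, by comparison with a multiple of the exponential series at [L * t]. *)
Lemma cvg_semigroup_series h (t : R) x : 0 <= t -> cvgn (series (coeff t h x)).
Proof.
(* The sum is a crude bound for the supremum norm of [h]. *)
move=> t0; pose a : R := \sum_y `|h y|.
have ha y : `|h y| <= a by rewrite /a (bigD1 y)//= lerDl sumr_ge0.
apply: normed_cvg; apply: (@series_le_cvg _ _ (a *: exp_coeff (L * t))).
- by move=> n; rewrite /= normr_ge0.
- move=> n; apply: mulr_ge0; first exact: (le_trans _ (ha x)).
  by apply: divr_ge0; rewrite ?exprn_ge0 ?mulr_ge0.
- by move=> n; rewrite [leRHS]mulrC; exact: coeff_bounded.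
- apply: is_cvg_seriesZ; exact: is_cvg_series_exp_coeff.
Qed.

Lemma iter_sum (P : pred Omega) (F : Omega -> Omega -> R) n x :
  iter n U (fun z => \sum_(i | P i) F i z) x = \sum_(i | P i) iter n U (F i) x.
Proof.
elim: n x => // n IHn x; rewrite iterS.
by rewrite (_ : iter n U _ = fun z => \sum_(i | P i) iter n U (F i) z) ?U_sum//;
  apply/funext.
Qed.

(** The indicator of [B] is a finite sum of point indicators, and finite sums commute with the
    limit. This turns the probability of lying in [B] at time [t] into the semigroup applied to one
    function. *)
Lemma transition_sum (B : pred Omega) (t : R) x : 0 <= t ->
  \sum_(y | B y) transition U t x y =
  limn (series (coeff t (fun z => (B z)%:R) x)).
Proof.
move=> t0; apply/esym/cvg_lim => //.
have BE : (fun z => (B z)%:R) = fun z => \sum_(y | B y) indicator R y z.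
  apply/funext => z; rewrite /indicator.
  have [Bz|nBz] := boolP (B z).
    rewrite (bigD1 z)//= eqxx big1 ?addr0// => y /andP[_].
    by rewrite eq_sym => /negPf ->.
  by rewrite big1// => y By; case: eqP nBz => // ->; rewrite By.
have -> : series (coeff t (fun z => (B z)%:R) x) =
    fun n => \sum_(y | B y) series (coeff t (indicator R y) x) n.
  rewrite BE; apply/funext => n; rewrite !seriesEnat /= exchange_big /=.
  by apply: eq_bigr => i _; rewrite /coeff iter_sum mulr_sumr.
rewrite /transition; apply: cvg_big => [|y _].
  exact: add_continuous.
exact: cvg_semigroup_series.
Qed.

(** Every term of the series after the zeroth contains a factor [U h], hence is controlled by [d].
    The condition [1 <= L] allows [L ^+ i] to be enlarged to [L ^+ i.+1], which makes the bounds
    terms of the exponential series. *)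
Lemma semigroup_near h (d t : R) x : 0 <= t -> 1 <= L ->
  (forall x, `|U h x| <= d) ->
  `|limn (series (coeff t h x)) - h x| <= d * expR (L * t).
Proof.
move=> t0 L1 hd.
have d0 : 0 <= d := le_trans (normr_ge0 _) (hd x).
have cvgS := @cvg_semigroup_series h t x t0.
have cvgE : (fun n => d * series (exp_coeff (L * t)) n) @ \oo -->
    d * expR (L * t).
  by apply: cvgZl_tmp; exact: is_cvg_series_exp_coeff.
have cvgD : (fun n => `|series (coeff t h x) n.+1 - h x|) @ \oo -->
    `|limn (series (coeff t h x)) - h x|.
  apply: cvg_norm; apply: cvgB; last exact: cvg_cst.
  by move: cvgS; rewrite -cvg_shiftS.
(* Both series are shifted by one, so that the zeroth term [h x] splits off and cancels. *)
rewrite -cvg_shiftS in cvgE; apply: (ler_cvg_to cvgD cvgE).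
apply: nearW => n /=.
rewrite !seriesEnat /= !big_nat_recl//= {1}/coeff expr0 fact0 divr1 mul1r.
rewrite addrC addKr mulrDr; apply: ler_wpDl.
  by rewrite /exp_coeff /= expr0 divr1 mulr_ge0.
apply: le_trans (ler_norm_sum _ _ _) _.
rewrite mulr_sumr; apply: ler_sum => i _; rewrite /coeff.
rewrite iterSr normrM ger0_norm ?divr_ge0 ?exprn_ge0 ?ler0n//.
have -> : d * exp_coeff (L * t) i.+1 = t ^+ i.+1 / i.+1`!%:R * (L ^+ i.+1 * d).
  by rewrite /exp_coeff /= exprMn ; ring.
apply: ler_wpM2l; first by rewrite divr_ge0 ?exprn_ge0.
apply: le_trans (iter_bounded i hd x) _.
by rewrite ler_wpM2r// exprS ler_peMl ?exprn_ge0.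
Qed.

End BoundedGenerator.

(** * Upper and lower bounds on mixing times *)

Section MixingBounds.
Local Open Scope classical_set_scope.
Local Open Scope ring_scope.
Variables (R : realType) (Omega : finType).
Implicit Types (U : (Omega -> R) -> Omega -> R) (mu nu : Omega -> R).

(** Only the part of the sum over [B] is kept. The factor 1/2 remains because the total masses of
    [mu] and [nu] are not assumed equal. *)
Lemma tv_dist_ge (B : pred Omega) mu nu :
  2^-1 * (\sum_(y | B y) mu y - \sum_(y | B y) nu y) <= tv_dist mu nu.
Proof.
rewrite /tv_dist ler_wpM2l ?invr_ge0// -sumrB [leRHS](bigID B)/=.
by rewrite ler_wpDr ?sumr_ge0// ler_sum// => y _; exact: ler_norm.
Qed.

Lemma tv_dist_le_mixing_time U t eps : 0 <= t ->
  (forall x, tv_dist (transition U t x) (equilibrium U) <= eps) ->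
  0 <= eps -> (mixing_time U eps <= t%:E)%E.
Proof.
move=> t0 tvle eps0; apply: ereal_inf_lbound; exists t => //; split=> //.
exact: bigmax_le.
Qed.

(** A metastable set: before time [T] the chain started at [x] is in [B] with probability at least
    7/8, while the equilibrium mass of [B] is at most 1/2. The distance is then at least (7/8 -
    1/2)/2 = 3/16, which exceeds 1/8. *)
Lemma mixing_time_ge U (L : R) (B : pred Omega) x (d T : R) :
  1 <= L ->
  (forall (P : pred Omega) (F : Omega -> Omega -> R) z,
    U (fun y => \sum_(i | P i) F i y) z = \sum_(i | P i) U (F i) z) ->
  (forall (h : Omega -> R) (a : R),
    (forall z, `|h z| <= a) -> forall z, `|U h z| <= L * a) ->
  (forall z, `|U (fun y => (B y)%:R) z| <= d) ->
  B x -> \sum_(y | B y) equilibrium U y <= 2^-1 ->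
  d * expR (L * T) <= 8^-1 ->
  (T%:E <= mixing_time U 8^-1)%E.
Proof.
move=> L1 Usum Ubd hd Bx piB dT; apply: le_ereal_inf_tmp => _ [t [t0 tvle] <-].
rewrite lee_fin leNgt; apply/negP => tT.
have L0 : 0 <= L by apply: le_trans L1.
have d0 : 0 <= d := le_trans (normr_ge0 _) (hd x).
have := semigroup_near L0 Ubd x t0 L1 hd.
rewrite -(transition_sum L0 Usum Ubd B x t0) Bx mulr1n ler_norml => /andP[+ _].
have : d * expR (L * t) <= d * expR (L * T).
  by rewrite ler_wpM2l// ler_expR ler_wpM2l// ltW.
have := le_trans (le_bigmax _ _ x) tvle.
have := tv_dist_ge B (transition U t x) (equilibrium U).
lra.
Qed.

(** * Chains that jump at rate [c] to a uniformly chosen state *)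

Section MeanReverting.
Variables (U : (Omega -> R) -> Omega -> R) (c : R).
Hypothesis Omega_gt0 : (0 < #|Omega|)%N.
Let N : R := #|Omega|%:R.
Hypothesis U_mean : forall h x, U h x = c * (N^-1 * \sum_y h y - h x).

Let N_neq0 : N != 0.
Proof. by rewrite pnatr_eq0 -lt0n. Qed.

Let mean_shift (h : Omega -> R) (m : R) :
  N^-1 * \sum_y (h y - m) = N^-1 * \sum_y h y - m.
Proof.
rewrite sumrB sumr_const mulrBr; congr (_ - _).
by rewrite -[m *+ _]mulr_natl mulrA mulVf ?mul1r.
Qed.

(** [U] kills constants and multiplies mean-zero functions by [- c], so after the first application
    only the centred part of [h] survives. *)
Lemma mean_reverting_iter h n x :
  iter n.+1 U h x = (- c) ^+ n.+1 * (h x - N^-1 * \sum_y h y).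
Proof.
elim: n x => [|n IHn] x; first by rewrite /= U_mean; ring.
rewrite iterS U_mean IHn (eq_bigr _ (fun y _ => IHn y)) -mulr_sumr mulrCA.
by rewrite mean_shift subrr mulr0 sub0r [in RHS]exprS; ring.
Qed.

Lemma mean_reverting_transition t x y :
  transition U t x y = expR (- c * t) * ((x == y)%:R - N^-1) + N^-1.
Proof.
(* The formula for the iterates starts at the first power, so the zeroth term is treated
   separately. *)
apply/cvg_lim => //; rewrite -cvg_shiftS.
have cvgE : (fun n => series (exp_coeff (- c * t)) n.+1 *
    ((x == y)%:R - N^-1) + N^-1) @ \oo -->
    expR (- c * t) * ((x == y)%:R - N^-1) + N^-1.
  apply: cvgD; last exact: cvg_cst.
  apply: cvgM; last exact: cvg_cst.
  rewrite (@cvg_shiftS _ (series (exp_coeff (- c * t)))).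
  exact: is_cvg_series_exp_coeff.
suff -> : [sequence series (fun n => t ^+ n / n`!%:R *
      iter n U (indicator R y) x) n.+1]_n =
    (fun n => series (exp_coeff (- c * t)) n.+1 *
      ((x == y)%:R - N^-1) + N^-1) by [].
apply/funext => n /=; rewrite !seriesEnat /= !big_nat_recl//=.
have -> : \sum_(0 <= i < n) t ^+ i.+1 / i.+1`!%:R *
      U (iter i U (indicator R y)) x =
    \sum_(0 <= i < n) exp_coeff (- c * t) i.+1 * ((x == y)%:R - N^-1).
  apply: eq_bigr => i _; have := mean_reverting_iter (indicator R y) i x.
  rewrite iterS => ->; rewrite {2}/indicator -/(indicator R y).
  have -> : \sum_z indicator R y z = 1.
    rewrite (bigD1 y)//= /indicator eqxx big1 ?addr0// => z.
    by move=> /negPf ->.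
  by rewrite /indicator /exp_coeff /= exprMn; ring.
rewrite -mulr_suml /exp_coeff /= /indicator !expr0 fact0.
by field.
Qed.

Lemma mean_reverting_equilibrium x : c != 0 -> equilibrium U x = N^-1.
Proof.
(* The uniform measure shows that an equilibrium exists; testing the chosen one against the
   indicator of [x] then determines its value there. *)
move=> c0; have [|_ pi1 /(_ (indicator R x))] := @getPex _ (is_equilibrium U).
  exists (fun _ => N^-1); split=> [_|| h]; first by rewrite invr_ge0 ler0n.
    by rewrite sumr_const -[_ *+ _]mulr_natl mulfV.
  rewrite -mulr_sumr (eq_bigr _ (fun y _ => U_mean h y)) -mulr_sumr.
  rewrite sumrB sumr_const -[_ *+ _]mulr_natl (mulVKf N_neq0) subrr.
  by rewrite !mulr0.
rewrite -/(equilibrium U) in pi1 *.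
under eq_bigr do rewrite U_mean mulrCA mulrBr.
rewrite -mulr_sumr sumrB -mulr_suml pi1 mul1r.
have -> : \sum_z indicator R x z = 1.
  rewrite (bigD1 x)//= /indicator eqxx big1 ?addr0// => z.
  by move=> /negPf ->.
rewrite (bigD1 x)//= {1}/indicator eqxx big1 ?addr0 => [|z zx]; last first.
  by rewrite /indicator (negPf zx) mulr0.
by move/eqP; rewrite mulf_eq0 (negPf c0)/= !mulr1 subr_eq0 => /eqP.
Qed.

(** The distance to equilibrium is [expR (- c * t)] times its initial value, which is at most 1; for
    [c >= 1] the factor is at most 1/4 at time [ln 4]. *)
Lemma mean_reverting_mixing_time : 1 <= c ->
  (mixing_time U 4^-1 <= (ln 4)%:E)%E.
Proof.
move=> c1; have c0 : c != 0 by rewrite gt_eqF// (lt_le_trans ltr01).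
have l4 : 0 <= ln 4 :> R by rewrite ln_ge0// ler1n.
apply: tv_dist_le_mixing_time => // x.
have e4 : expR (- c * ln 4) <= 4^-1 :> R.
  rewrite -[leRHS]lnK ?posrE// ler_expR lnV ?posrE//.
  by rewrite mulNr lerN2 ler_peMl.
apply: le_trans e4; rewrite /tv_dist.
under eq_bigr do rewrite mean_reverting_transition mean_reverting_equilibrium//
  addrK normrM (ger0_norm (expR_ge0 _)).
rewrite -mulr_sumr mulrCA ler_piMr ?expR_ge0//.
have : \sum_y `|(x == y)%:R - N^-1| <= \sum_y ((x == y)%:R + N^-1).
  apply: ler_sum => y _; apply: le_trans (ler_normB _ _) _.
  by rewrite !ger0_norm ?invr_ge0 ?ler0n.
rewrite big_split/= sumr_const -[_ *+ _]mulr_natl mulfV//.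
suff -> : \sum_y (x == y)%:R = 1 :> R by lra.
rewrite (bigD1 x)//= eqxx big1 ?addr0// => y.
by rewrite eq_sym => /negPf ->.
Qed.

End MeanReverting.
End MixingBounds.

(** * Shuffles with a single edge containing all vertices *)

Section CompleteEdge.
Variables (R : realType) (V : finType).
Implicit Types (w : {perm V} -> R).

Definition complete_edge : {set {set V}} := [set [set: V]].

Lemma Sym_setT : Sym [set: V] = [set: {perm V}].
Proof.
by apply/setP => s; rewrite !inE; apply/fintype.subsetP => v; rewrite !inE.
Qed.

Section Act.
Variables (w : {perm V} -> R) (Omega : finType).
Variable act : {perm V} -> Omega -> Omega.
Hypothesis w_ge0 : forall s, 0 <= w s.
Hypothesis w_sum : \sum_s w s = 1.

Let U := shuffle_generator complete_edge (fun _ => w) act.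

Lemma shuffle_completeE h x : U h x = \sum_s w s * (h (act s x) - h x).
Proof.
rewrite /U /shuffle_generator big_set1 Sym_setT.
by apply: eq_bigl => s; rewrite inE.
Qed.

Lemma shuffle_complete_sum (P : pred Omega) (F : Omega -> Omega -> R) x :
  U (fun z => \sum_(i | P i) F i z) x = \sum_(i | P i) U (F i) x.
Proof.
rewrite shuffle_completeE.
under [RHS]eq_bigr do rewrite shuffle_completeE.
rewrite exchange_big/=; apply: eq_bigr => s _.
by rewrite -sumrB mulr_sumr.
Qed.

(** The total jump rate is 1 and each difference is at most [2 * a]; this is the source of the
    constant 2 in the exponents below. *)
Lemma shuffle_complete_bounded (h : Omega -> R) (a : R) :
  (forall x, `|h x| <= a) -> forall x, `|U h x| <= 2 * a.
Proof.
move=> ha x; rewrite shuffle_completeE.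
apply: le_trans (ler_norm_sum _ _ _) _.
rewrite -[leRHS]mul1r -[X in X * (2 * a)]w_sum mulr_suml; apply: ler_sum => s _.
rewrite normrM ger0_norm// ler_wpM2l//.
apply: le_trans (ler_normB _ _) _.
by rewrite mulr_natl mulr2n lerD.
Qed.

(** Each permutation acts bijectively, so the uniform measure is stationary and the choice made by
    [equilibrium] is meaningful; [x0] makes the state space nonempty. *)
Lemma shuffle_complete_equilibrium (x0 : Omega) :
  (forall s, injective (act s)) -> is_equilibrium U (equilibrium U).
Proof.
move=> act_inj; apply: getPex.
have N0 : #|Omega|%:R != 0 :> R by rewrite pnatr_eq0 (cardD1 x0).
exists (fun _ => #|Omega|%:R^-1); split=> [_||h].
- by rewrite invr_ge0 ler0n.
- by rewrite sumr_const -[_ *+ _]mulr_natl mulfV.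
rewrite -mulr_sumr; under eq_bigr do rewrite shuffle_completeE.
rewrite exchange_big big1 ?mulr0// => s _.
rewrite -mulr_sumr sumrB [X in _ - X](reindex_inj (act_inj s))/= subrr.
by rewrite mulr0.
Qed.

Lemma shuffle_complete_rate x y : x != y ->
  U (indicator R y) x = \sum_s w s * (act s x == y)%:R.
Proof.
move=> xy; rewrite shuffle_completeE; apply: eq_bigr => s _.
by rewrite /indicator (negPf xy) subr0.
Qed.

End Act.

(** The symmetric group is [#|V|]-transitive, hence [k]-transitive for every smaller [k]. *)
Lemma perm_extension k (x y : k.-tuple V) : uniq x -> uniq y ->
  exists s : {perm V}, map_tuple s x = y.
Proof.
move=> ux uy.
have km : (k <= #|V|)%N by rewrite -(size_tuple x) -(card_uniqP ux) max_card.
have dt (t : k.-tuple V) : uniq t -> t \in k.-dtuple([set: V]).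
  by move=> ut; rewrite inE ut; apply/fintype.subsetP => ? _; rewrite inE.
have tr := ntransitive_weak km (alt.Sym_trans V).
have [s _ ->] := atransP2 tr (dt x ux) (dt y uy).
by exists s; apply: eq_from_tnth => i; rewrite !tnth_map.
Qed.

(** With full support, any injective tuple reaches any other in a single jump. *)
Lemma IP_complete_irreducible w k : (forall s, 0 < w s) ->
  irreducible_chain (IP k (fun _ => w) complete_edge).
Proof.
move=> w0 x y; have [->|xy] := eqVneq x y; first exact: connect0.
apply: connect1; rewrite /IP shuffle_complete_rate//.
have [s sxy] := perm_extension (valP x) (valP y).
rewrite (bigD1 s)//= ltr_wpDr//.
  by apply: sumr_ge0 => t _; rewrite mulr_ge0 ?ler0n// ltW.
have -> : act_kinjective s x = y by exact: val_inj.
by rewrite eqxx mulr1.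
Qed.

Lemma act_ksubset_inj k (s : {perm V}) : injective (@act_ksubset V k s).
Proof.
by move=> A B /(congr1 val)/= /(imset_inj (@perm_inj _ s))/val_inj.
Qed.

Lemma act_ksubsetM k (s t : {perm V}) (A : ksubset V k) :
  act_ksubset (s * t)%g A = act_ksubset t (act_ksubset s A).
Proof.
apply: val_inj => /=; rewrite -imset_comp; apply: eq_imset => v.
by rewrite /= permM.
Qed.

Lemma ksubset1P (A : ksubset V 1) : exists a, val A = [set a].
Proof. exact/cards1P/(valP A). Qed.

Lemma ksubset1_2transitive (A B A' B' : ksubset V 1) : A != B -> A' != B' ->
  exists s, act_ksubset s A = A' /\ act_ksubset s B = B'.
Proof.
have [[a Aa] [b Bb]] := (ksubset1P A, ksubset1P B).
have [[a' Aa'] [b' Bb']] := (ksubset1P A', ksubset1P B').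
move=> AB AB'.
have ab : a != b.
  by apply: contra_neq AB => ab; apply: val_inj; rewrite Aa Bb ab.
have ab' : a' != b'.
  by apply: contra_neq AB' => ab'; apply: val_inj; rewrite Aa' Bb' ab'.
have [||s [sa sb]] := @perm_extension 2 [tuple a; b] [tuple a'; b'].
- by rewrite /= inE ab.
- by rewrite /= inE ab'.
exists s; split; apply: val_inj.
- by rewrite /= Aa Aa' imset_set1 sa.
- by rewrite /= Bb Bb' imset_set1 sb.
Qed.

Lemma card_ksubset1 : #|{: ksubset V 1}| = #|V|.
Proof.
rewrite card_sig -[RHS]bin1 -card_draws -[LHS]cardsE.
by apply: eq_card => A; rewrite !inE.
Qed.

(* Conjugation invariance makes all jump rates between distinct vertices equal,
   so a single particle performs the walk on the complete graph. *)
Lemma EX1_complete_mean_reverting w : (1 < #|V| <= 5)%N ->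
  \sum_s w s = 1 -> (forall s t, w (s ^ t)%g = w s) ->
  (forall v, \sum_s w s * (s v == v)%:R <= 5^-1) ->
  exists2 c : R, 1 <= c & forall h x, EX 1 (fun _ => w) complete_edge h x =
    c * (#|{: ksubset V 1}|%:R^-1 * \sum_y h y - h x).
Proof.
move=> /andP[V1 V5] w_sum wJ w_fix.
pose p A B := \sum_s w s * (@act_ksubset V 1 s A == B)%:R.
(* Conjugating the summation variable by [t] leaves the weight unchanged and moves both
   endpoints. *)
have p_inv t A B : p (act_ksubset t A) (act_ksubset t B) = p A B.
  rewrite /p (reindex_inj (@conjg_inj _ t)); apply: eq_bigr => s _.
  rewrite wJ -act_ksubsetM -conjgC act_ksubsetM.
  by rewrite (inj_eq (@act_ksubset_inj _ _)).
have p_const A B A' B' : A != B -> A' != B' -> p A B = p A' B'.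
  move=> AB AB'; have [t [<- <-]] := ksubset1_2transitive AB AB'.
  by rewrite p_inv.
have EXE h A : EX 1 (fun _ => w) complete_edge h A =
    \sum_B p A B * (h B - h A).
  rewrite /EX shuffle_completeE /p.
  under [RHS]eq_bigr do rewrite mulr_suml.
  rewrite exchange_big; apply: eq_bigr => s _ /=.
  rewrite (bigD1 (act_ksubset s A))//= eqxx mulr1 big1 ?addr0// => B.
  by rewrite eq_sym => /negPf ->; rewrite mulr0 mul0r.
have p_sum A : \sum_B p A B = 1.
  rewrite /p exchange_big -[RHS]w_sum; apply: eq_bigr => s _ /=.
  rewrite (bigD1 (act_ksubset s A))//= eqxx mulr1 big1 ?addr0// => B.
  by rewrite eq_sym => /negPf ->; rewrite mulr0.
have p_stay A : p A A <= 5^-1.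
  have [a Aa] := ksubset1P A; apply: le_trans (w_fix a).
  rewrite le_eqVlt; apply/orP; left; apply/eqP; apply: eq_bigr => s _.
  by rewrite -(inj_eq val_inj) /= Aa imset_set1 (inj_eq (@finset.set1_inj _)).
have N1 : (1 < #|{: ksubset V 1}|)%N by rewrite card_ksubset1.
have [A [B [_ _ AB]]] := card_gt1P N1.
pose q := p A B; pose N : R := #|{: ksubset V 1}|%:R.
have N0 : N != 0 by rewrite pnatr_eq0 -lt0n ltnW.
(* From [p A A + (N - 1) * q = 1], [p A A <= 1/5] and [N <= 5] one gets [q >= 1/5], hence
   [q * N = (N - 1) * q + q >= 1]. *)
exists (q * N).
  have : p A A + (N - 1) * q = 1.
    rewrite -[RHS](p_sum A) (bigD1 A)//=; congr (_ + _).
    rewrite (eq_bigr (fun _ => q)) => [|C CA]; last first.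
      by apply: p_const; rewrite // eq_sym.
    rewrite sumr_const -[RHS]mulr_natl; congr (_ * q).
    have -> : N = #|{: ksubset V 1}|.-1.+1%:R by rewrite prednK// ltnW.
    rewrite mulrSr addrK; congr _%:R.
    by rewrite -(cardC1 A); apply: eq_card.
  have : N <= 5 by rewrite /N card_ksubset1 ler_nat.
  have : 1 < N by rewrite ltr1n.
  have := p_stay A => pA N_gt1 N5 pq.
  have q0 : 0 < q by rewrite -(@pmulr_rgt0 _ (N - 1)) ?subr_gt0//; lra.
  have : 0 <= (5 - N) * q by rewrite mulr_ge0 ?subr_ge0// ltW.
  lra.
move=> h x; rewrite EXE.
(* The diagonal rate may also be replaced by [q], since its increment vanishes. *)
rewrite (eq_bigr (fun y => q * (h y - h x))) => [|y _]; last first.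
  by have [->|yx] := eqVneq y x; rewrite ?subrr ?mulr0//
    (p_const x y A B)// eq_sym.
rewrite -mulr_sumr sumrB sumr_const -mulrA; congr (_ * _).
by rewrite mulrBr (mulVKf N0) mulr_natl.
Qed.

End CompleteEdge.

(** * The perturbed double transpositions on four vertices *)

Section FourVertices.
Variables (R : realType) (V : finType) (d : R).

(** On four points these are the three double transpositions, described in a way that is visibly
    invariant under conjugation. *)
Definition fpf_involutions : {set {perm V}} :=
  [set s : {perm V} | ((s * s)%g == 1%g) && [forall v, s v != v]].

Definition perturbed_involution_weight (s : {perm V}) : R :=
  (1 - d) * ((s \in fpf_involutions)%:R / #|fpf_involutions|%:R) +
  d / #|{: {perm V}}|%:R.

Local Notation K := fpf_involutions.
Local Notation w := perturbed_involution_weight.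

Hypothesis V4 : #|V| = 4%N.
Hypothesis K_gt0 : (0 < #|K|)%N.
Hypothesis d_gt0 : 0 < d.
Hypothesis d_le : d <= 5^-1.

Let perm_neq0 : #|{: {perm V}}|%:R != 0 :> R.
Proof. by rewrite pnatr_eq0 (cardD1 1%g). Qed.

Let K_neq0 : #|K|%:R != 0 :> R.
Proof. by rewrite pnatr_eq0 -lt0n. Qed.

Lemma fpf_involutionJ s t : ((s ^ t)%g \in K) = (s \in K).
Proof.
rewrite !inE -conjMg -[X in _ == X](conj1g t) (inj_eq (@conjg_inj _ t)).
congr (_ && _); apply/forallP/forallP => sv v.
  by have := sv (t v); rewrite permJ (inj_eq (@perm_inj _ t)).
by rewrite -(permKV t v) permJ (inj_eq (@perm_inj _ t)).
Qed.

Lemma weightJ s t : w (s ^ t)%g = w s.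
Proof. by rewrite /perturbed_involution_weight fpf_involutionJ. Qed.

Lemma weight_notin s : s \notin K -> w s = d / #|{: {perm V}}|%:R.
Proof.
by rewrite /perturbed_involution_weight => /negPf ->; rewrite mul0r mulr0 add0r.
Qed.

Lemma weight_gt0 s : 0 < w s.
Proof.
rewrite ltr_wpDl//; last by rewrite divr_gt0// lt0r perm_neq0 ler0n.
rewrite mulr_ge0 ?divr_ge0 ?ler0n// subr_ge0 (le_trans d_le)//.
by rewrite invf_le1 ?ler1n.
Qed.

Lemma uniform_sum : \sum_(s : {perm V}) d / #|{: {perm V}}|%:R = d.
Proof. by rewrite sumr_const -[_ *+ _]mulr_natl mulrCA mulfV// mulr1. Qed.

Lemma weight_sum : \sum_s w s = 1.
Proof.
rewrite big_split/= uniform_sum -mulr_sumr -mulr_suml.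
have -> : \sum_s (s \in K)%:R = #|K|%:R :> R.
  rewrite -sum1_card natr_sum [RHS]big_mkcond.
  by apply: eq_bigr => s _; case: ifP.
by rewrite mulfV// mulr1 subrK.
Qed.

(** Elements of [K] fix no vertex, so only the uniform part, of total mass [d], contributes; this is
    where [d <= 1/5] enters. *)
Lemma weight_fixed v : \sum_s w s * (s v == v)%:R <= 5^-1.
Proof.
apply: le_trans d_le; rewrite -[leRHS]uniform_sum; apply: ler_sum => s _.
have u0 : 0 <= d / #|{: {perm V}}|%:R by rewrite divr_ge0 ?ler0n// ltW.
have [sK|sK] := boolP (s \in K); last first.
  by rewrite weight_notin// ler_piMr// lern1 leq_b1.
by move: sK; rewrite inE => /andP[_ /forallP/(_ v)/negPf ->]; rewrite mulr0.
Qed.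

(** If [s] does not exchange the two points of [A], it sends both outside [A], and on four vertices
    the complement has room for just these two. *)
Lemma fpf_involution_pair s (A : {set V}) : s \in K -> #|A| = 2%N ->
  s @: A = A \/ s @: A = ~: A.
Proof.
rewrite inE => /andP[/eqP ss /forallP sv] A2.
have sK v : s (s v) = v by rewrite -permM ss perm1.
have [a [b [ab AE]]] : exists a b, a != b /\ A = [set a; b].
  by move/eqP/cards2P: A2 => [a [b [ab ->]]]; exists a, b.
have cardsA : #|s @: A| = 2%N by rewrite card_imset//; exact: perm_inj.
have [sab|sab] := eqVneq (s a) b.
  by left; rewrite AE imsetU1 imset_set1 -sab sK finset.setUC.
right; apply/eqP; rewrite eqEcard cardsA cardsCs finset.setCK A2 V4 leqnn andbT.
rewrite AE imsetU1 imset_set1; apply/fintype.subsetP => v.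
rewrite !inE => /orP[]/eqP->; rewrite negb_or.
  by rewrite sv sab.
rewrite sv andbT; apply: contra_neq sab => sba.
by rewrite -sba sK.
Qed.

Definition matching (A : {set V}) (X : ksubset V 2) : bool :=
  (val X == A) || (val X == ~: A).

Lemma matching_act s A X : s \in K ->
  matching A (act_ksubset s X) = matching A X.
Proof.
move=> sK; rewrite /matching /=.
have [->//|->] := fpf_involution_pair sK (eqP (valP X)).
by rewrite orbC !(can2_eq (@finset.setCK V) (@finset.setCK V)) finset.setCK.
Qed.

Let E := complete_edge V.
Let f : {set V} -> {perm V} -> R := fun=> w.

(** Elements of [K] do not change the indicator, and the remaining permutations have total rate at
    most [d]. *)
Lemma matching_metastable A X : `|EX 2 f E (fun Y => (matching A Y)%:R) X| <= d.
Proof.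
rewrite /EX shuffle_completeE; apply: le_trans (ler_norm_sum _ _ _) _.
rewrite -[leRHS]uniform_sum; apply: ler_sum => s _.
have u0 : 0 <= d / #|{: {perm V}}|%:R by rewrite divr_ge0 ?ler0n// ltW.
have [sK|sK] := boolP (s \in K).
  by rewrite matching_act// subrr mulr0 normr0.
rewrite weight_notin// normrM ger0_norm// ler_piMr//.
by case: matching; case: matching;
  rewrite ?subrr ?subr0 ?sub0r ?normrN ?normr0 ?normr1.
Qed.

Lemma weight_edge_distributions : edge_distributions E f.
Proof.
move=> e; rewrite inE => /eqP ->; split=> [s _|]; first exact/ltW/weight_gt0.
by rewrite Sym_setT -[RHS]weight_sum; apply: eq_bigl => s; rewrite inE.
Qed.

Lemma weight_assumptionA : assumptionA f E.
Proof.
split.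
- exists 1%N => v; rewrite -[RHS](cards1 [set: V]); congr #|pred_of_set _|.
  by apply/setP => e; rewrite !inE andb_idr// => /eqP ->; rewrite inE.
- by move=> e _ s t _ /imsetP[u _ ->]; exact: weightJ.
- move=> e v; rewrite inE => /eqP -> _; apply: le_trans (weight_fixed v).
  by rewrite Sym_setT le_eqVlt; apply/orP; left; apply/eqP;
    apply: eq_bigl => s; rewrite inE.
- by move=> k _; apply: IP_complete_irreducible; exact: weight_gt0.
Qed.

Lemma EX1_mixing_time : (mixing_time (EX 1 f E) 4^-1 <= (ln 4)%:E)%E.
Proof.
have [||c c1 EXE] := @EX1_complete_mean_reverting R V w _ weight_sum weightJ.
- by rewrite V4.
- exact: weight_fixed.
apply: mean_reverting_mixing_time EXE c1.
by rewrite card_ksubset1 V4.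
Qed.

(** Distinct perfect matchings share no pair. Hence of two such events at least one has equilibrium
    mass at most 1/2, whatever the equilibrium is. *)
Lemma matching_disjoint a b c (X : ksubset V 2) : a != b -> a != c -> b != c ->
  matching [set a; b] X -> ~~ matching [set a; c] X.
Proof.
move=> ab ac bc.
have bA : b \notin [set a; c] by rewrite !inE negb_or eq_sym ab bc.
have ABn : [set a; b] != [set a; c].
  by apply: contraNneq bA => <-; rewrite !inE eqxx orbT.
have ABCn : [set a; b] != ~: [set a; c].
  by apply/eqP => /setP/(_ a); rewrite !inE eqxx.
have CK := can2_eq (@finset.setCK V) (@finset.setCK V).
by rewrite /matching negb_or => /orP[]/eqP ->;
  rewrite ?(inj_eq (@finset.setC_inj V)) ?CK ?ABn ?ABCn.
Qed.

Lemma EX2_mixing_time T : d * expR (2 * T) <= 8^-1 ->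
  (T%:E <= mixing_time (EX 2 f E) 8^-1)%E.
Proof.
move=> dT.
have [a [b [c [ab ac bc]]]] : exists a b c : V, [/\ a != b, a != c & b != c].
  have /card_gt2P[a [b [c [_ [ab bc ca]]]]] : (2 < #|V|)%N by rewrite V4.
  by exists a, b, c; split=> //; rewrite eq_sym.
have pairP (u v : V) : u != v -> #|[set u; v]| == 2%N.
  by move=> uv; rewrite cards2 uv.
pose Xb : ksubset V 2 :=
  exist (fun A : {set V} => #|A| == 2%N) _ (pairP _ _ ab).
pose Xc : ksubset V 2 :=
  exist (fun A : {set V} => #|A| == 2%N) _ (pairP _ _ ac).
have [pi_ge0 pi1 _] : is_equilibrium (EX 2 f E) (equilibrium (EX 2 f E)).
  by apply: (shuffle_complete_equilibrium w Xb) => s; exact: act_ksubset_inj.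
have lower X (A : {set V}) : matching A X ->
    \sum_(Y | matching A Y) equilibrium (EX 2 f E) Y <= 2^-1 ->
    (T%:E <= mixing_time (EX 2 f E) 8^-1)%E.
  move=> XA piA; apply: (@mixing_time_ge _ _ _ 2 (matching A) X d) => //.
  - by rewrite ler1n.
  - exact: shuffle_complete_sum.
  - by apply: shuffle_complete_bounded weight_sum => s; exact/ltW/weight_gt0.
  - exact: matching_metastable.
(* The chain is started in whichever of the two matchings is light: if the first has mass above 1/2,
   the second lies in its complement. *)
have [|piB] :=
  leP (\sum_(Y | matching [set a; b] Y) equilibrium (EX 2 f E) Y) 2^-1.
  by apply: (lower Xb); rewrite /matching eqxx.
apply: (lower Xc [set a; c]); first by rewrite /matching eqxx.
move: pi1; rewrite (bigID (matching [set a; b]))/= => pi1.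
have : \sum_(Y | matching [set a; c] Y) equilibrium (EX 2 f E) Y <=
    \sum_(Y | ~~ matching [set a; b] Y) equilibrium (EX 2 f E) Y.
  rewrite [leRHS](bigID (matching [set a; c]))/= ler_wpDr ?sumr_ge0//.
  rewrite le_eqVlt; apply/orP; left; apply/eqP; apply: eq_bigl => Y.
  rewrite andb_idl// => YA; apply: contraTN YA => YB.
  exact: matching_disjoint ab ac bc YB.
lra.
Qed.

End FourVertices.

(** * Choice of the parameters for a given [C] *)

Theorem mainTheorem2 (R : realType) (C : R) (C_gt0 : 0 < C) :
  exists (V : finType) (E : {set {set V}}) (f : {set V} -> {perm V} -> R),
    edge_distributions E f /\ assumptionA f E /\
    exists (k : nat) (eps : R),
      (1 <= k <= #|V| - 1)%N /\ 0 < eps < 1 /\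
      ((C * ln (#|V|%:R / eps))%:E * mixing_time (EX 1 f E) 4^-1
         < mixing_time (EX k f E) eps)%E.
Proof.
(* [M] bounds the one-particle side for [#|V| = 4], [eps = 1/8] and mixing time at most [ln 4];
   adding 1 makes the final inequality strict. *)
pose M : R := C * ln (4 / 8^-1) * ln 4; pose T := M + 1.
have l32 : 0 <= ln (4 / 8^-1) :> R.
  by rewrite ln_ge0// invrK -natrM ler1n.
have l4 : 0 <= ln 4 :> R by rewrite ln_ge0// ler1n.
have M0 : 0 <= M by rewrite !mulr_ge0// ltW.
(* Chosen so that [d * expR (2 * T)] equals 1/8, the threshold of [EX2_mixing_time]. *)
pose d : R := 8^-1 * expR (- (2 * T)).
have d0 : 0 < d by rewrite mulr_gt0 ?expR_gt0// invr_gt0 ltr0n.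
have d5 : d <= 5^-1.
  have : expR (- (2 * T)) <= 1 by rewrite -[leRHS]expR0 ler_expR /T; lra.
  rewrite /d; lra.
have V4 : #|'I_4| = 4%N by rewrite card_ord.
have K0 : (0 < #|fpf_involutions 'I_4|)%N.
  (* The reversal of four points exchanges 0 with 3 and 1 with 2. *)
  apply/card_gt0P; exists (perm (can_inj (@rev_ordK 4))); rewrite inE.
  apply/andP; split.
    by apply/eqP/permP => i; rewrite permM !permE rev_ordK.
  by apply/forallP => i; rewrite permE; case: i => [[|[|[|[|]]]]].
exists 'I_4, (complete_edge 'I_4), (fun=> perturbed_involution_weight d).
split; first exact: weight_edge_distributions.
split; first exact: weight_assumptionA.
exists 2%N, 8^-1; rewrite V4; split=> //; split.
  by rewrite invr_gt0 ltr0n invf_lt1 ?ltr0n ?ltr1n.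
have dT : d * expR (2 * T) <= 8^-1.
  by rewrite /d -mulrA -expRD addNr expR0 mulr1.
apply: lt_le_trans (EX2_mixing_time V4 K0 d0 d5 dT).
apply: (@le_lt_trans _ _ M%:E); last by rewrite lte_fin ltrDl.
rewrite [leRHS]EFinM; apply: lee_wpmul2l.
  by rewrite lee_fin mulr_ge0// ltW.
exact: EX1_mixing_time.
Qed.
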